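(* Suppose a system $\dot{\mathbf{x}}=\mathbf{f}(\mathbf{x},t)$ with $N$ degrees of freedom and nonlinearity $\phi$, whose response has two base frequencies $\omega_1,\omega_2$, and suppose that the ratio $\omega_1/\omega_2$ is irrational. Let $p$ be the truncation order, and consider the order-$p$ multiple harmonic balance (MHB) system $\nabla\hat{\mathbf{x}}=\hat{\mathbf{f}}(\hat{\mathbf{x}})$ and the order-$p$ reconstruction multiple harmonic balance (RMHB) system $\mathbf{E}^*\mathbf{E}\nabla\hat{\mathbf{x}}=\mathbf{E}^*\tilde{\mathbf{f}}_M(\mathbf{E}\hat{\mathbf{x}})$ with sampling period $T$ and $M$ collocation nodes. Then the RMHB is equivalent to the MHB only if the sampling period $T$ and the number of collocations $M$ are both infinite.
   Context: Index sets. For an integer $q\ge1$, $\Omega_q$ is the set of integer pairs $(m,n)$ with $|m|+|n|\le q$, with one representative kept from each pair $\pm(m,n)$ (say $n>0$, or $n=0$ and $m\ge0$). It consists of $(0,0)$ and $q(q+1)$ nonzero elements. Write $\mathrm{c}^{m,n}(t)=\cos((m\omega_1+n\omega_2)t)$ and $\mathrm{s}^{m,n}(t)=\sin((m\omega_1+n\omega_2)t)$. Truncated response. With truncation order $p\ge1$, each component of $\mathbf{x}=[x_1,\dots,x_N]^{\mathrm T}$ is approximated by $$x_i(t)=\hat{x}_{ic}(0,0)+\sum_{(m,n)\in\Omega_p\setminus\{(0,0)\}}\big[\hat{x}_{ic}(m,n)\,\mathrm{c}^{m,n}(t)+\hat{x}_{is}(m,n)\,\mathrm{s}^{m,n}(t)\big].$$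 The vector $\hat{\mathbf{x}}\in\mathbb{R}^{N(2p(p+1)+1)}$ collects all these real coefficients, component by component; within each component the constant term comes first, followed by the pair (cosine coefficient, sine coefficient) for each nonzero $(m,n)\in\Omega_p$ in a fixed order. Nonlinearity $\phi$. $\mathbf{f}$ is polynomial in $\mathbf{x}$ of degree $\phi$ (as for $x^\phi$), so that along a truncated response each component of $\mathbf{f}(\mathbf{x}(t),t)$ expands by product-to-sum identities (keeping track of the integer labels of the harmonics) as $\sum_{(\bar m,\bar n)\in\Omega_{\phi p}}[\hat f_c(\bar m,\bar n)\,\mathrm{c}^{\bar m,\bar n}(t)+\hat f_s(\bar m,\bar n)\,\mathrm{s}^{\bar m,\bar n}(t)]$, with coefficients polynomial in $\hat{\mathbf{x}}$. The vector $\hat{\mathbf{f}}(\hat{\mathbf{x}})$ collects, in the same order as $\hat{\mathbf{x}}$, only the coefficients labelled by $(m,n)\in\Omega_p$. MHB system. $\nabla\hat{\mathbf{x}}=\hat{\mathbf{f}}(\hat{\mathbf{x}})$, obtained by balancing the harmonics labelled by $\Omega_p$ (Galerkin method), where $\nabla=\mathbf{I}_N\otimes\mathrm{diag}[0,\nabla_{1,0},\dots,\nabla_{m,n},\dots,\nabla_{0,p}]$ has one block $$\nabla_{m,n}=\begin{bmatrix}0& m\omega_1+n\omega_2\\-(m\omega_1+n\omega_2)&0\end{bmatrix}$$ for each nonzero element of $\Omega_p$, $\mathbf{I}_N$ is the $N\times N$ identity matrix and $\otimes$ is the Kronecker product. RMHB system. Let $t_i=T(i-1)/M$, $i=1,\dots,M$,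 be $M$ equally spaced nodes over the sampling period $T$. Let $B$ be the $M\times(2p(p+1)+1)$ matrix whose $i$-th row is $[1,\dots,\mathrm{c}^{m,n}(t_i),\mathrm{s}^{m,n}(t_i),\dots]$ (same fixed order), and let $B^*$ be the matrix obtained from $\frac{2}{M}B^{\mathrm T}$ by multiplying its first row by $\frac12$. The collocation matrix is $\mathbf{E}=\mathbf{I}_N\otimes B$ and the transformation matrix is $\mathbf{E}^*=\mathbf{I}_N\otimes B^*$. The vector $\mathbf{E}\hat{\mathbf{x}}$ contains the values of the components of $\mathbf{x}$ at the nodes, stacked component by component, and $\tilde{\mathbf{f}}_M(\mathbf{E}\hat{\mathbf{x}})$ contains the values of the components of $\mathbf{f}(\mathbf{x}(t_i),t_i)$ at the nodes, stacked in the same way. The RMHB system is $\mathbf{E}^*\mathbf{E}\nabla\hat{\mathbf{x}}=\mathbf{E}^*\tilde{\mathbf{f}}_M(\mathbf{E}\hat{\mathbf{x}})$. Equivalence. The RMHB is equivalent to the MHB when (a) $\mathbf{E}^*\mathbf{E}$ is an identity matrix and (b) $\hat{\mathbf{f}}(\hat{\mathbf{x}})=\mathbf{E}^*\tilde{\mathbf{f}}_M(\mathbf{E}\hat{\mathbf{x}})$, so that the two algebraic systems coincide. ''Infinite'' $T$ and $M$ refers to the limiting situation in which both tend to infinity, the normalized trigonometric sums over the nodes that occur in (a) and (b) being replaced by their limits. *)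

(* Defs.v *)
From HB Require Import structures.
From mathcomp Require Import all_boot all_order all_algebra.
From mathcomp Require Import mxtens.
From mathcomp Require Import all_classical all_reals all_analysis.

Set Implicit Arguments.
Unset Strict Implicit.
Unset Printing Implicit Defensive.
Import Order.TTheory GRing.Theory Num.Theory.
Import numFieldNormedType.Exports.

Local Open Scope ring_scope.
Local Open Scope classical_set_scope.

Definition label := (int * int)%type.

Definition zrange (q : nat) : seq int :=
  [seq i%:Z - q%:Z | i <- iota 0 (q.*2.+1)].

(* The representative kept from +-(m, n) has n > 0, or n = 0 and m >= 0.  The
   enumeration goes by increasing n, then increasing m, so that it starts with
   (0, 0), (1, 0) and ends with (0, q). *)
Definition Omega (q : nat) : seq label :=
  [seq l <- [seq (m, n) | n <- zrange q, m <- zrange q] |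
     (`|l.1| + `|l.2| <= q)%N &&
     ((0 < l.2) || ((l.2 == 0) && (0 <= l.1)))].

Variant wave := Cos of label | Sin of label.

(* The functions attached to the coefficients of one component, in order. *)
Definition harmonics (p : nat) : seq wave :=
  Cos (0, 0) ::
  flatten [seq [:: Cos l; Sin l] | l <- Omega p & l != (0, 0)].

Definition hdim (p : nat) : nat := size (harmonics p).

Definition hbasis (p : nat) (j : 'I_(hdim p)) : wave :=
  nth (Cos (0, 0)) (harmonics p) j.

Section Evaluation.
Context {R : realType}.

Definition freq (w1 w2 : R) (l : label) : R := l.1%:~R * w1 + l.2%:~R * w2.

Definition heval (w1 w2 : R) (h : wave) (t : R) : R :=
  match h with
  | Cos l => cos (freq w1 w2 l * t)
  | Sin l => sin (freq w1 w2 l * t)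
  end.

(* A formal linear combination of labelled harmonics; labels need not be
   reduced to the representatives of Omega, and may be repeated. *)
Definition tpoly := seq (R * wave).

Definition teval (w1 w2 : R) (P : tpoly) (t : R) : R :=
  \sum_(u <- P) u.1 * heval w1 w2 u.2 t.

(* Product-to-sum identities. *)
Definition hmul (h k : wave) : tpoly :=
  match h, k with
  | Cos a, Cos b => [:: (2^-1, Cos (a - b)); (2^-1, Cos (a + b))]
  | Sin a, Sin b => [:: (2^-1, Cos (a - b)); (- 2^-1, Cos (a + b))]
  | Sin a, Cos b => [:: (2^-1, Sin (a + b)); (2^-1, Sin (a - b))]
  | Cos a, Sin b => [:: (2^-1, Sin (a + b)); (- 2^-1, Sin (a - b))]
  end.

Definition tone : tpoly := [:: (1, Cos (0, 0))].

Definition tscale (c : R) (P : tpoly) : tpoly := [seq (c * u.1, u.2) | u <- P].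

Definition tmul (P Q : tpoly) : tpoly :=
  flatten [seq tscale (u.1 * v.1) (hmul u.2 v.2) | u <- P, v <- Q].

Definition texp (P : tpoly) (k : nat) : tpoly := iter k (tmul P) tone.

(* Coefficient of h in P once cos (- l) = cos l, sin (- l) = - sin l and
   sin 0 = 0 have been used to collect the terms labelled l and - l. *)
Definition hcoef (k h : wave) : R :=
  match k, h with
  | Cos a, Cos l => ((a == l) || (a == - l))%:R
  | Sin a, Sin l => (a == l)%:R - (a == - l)%:R
  | _, _ => 0
  end.

Definition tcoef (P : tpoly) (h : wave) : R :=
  \sum_(u <- P) u.1 * hcoef u.2 h.

End Evaluation.
Arguments tpoly : clear implicits.

(* A vector field that is polynomial in x, with coefficients trigonometric
   polynomials in t:
     f_i (x, t) = sum over |a| <= phi of (F i a) (t) * x_1 ^ a_1 ... x_N ^ a_N. *)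
Definition polyfield (R : realType) (N phi : nat) :=
  'I_N -> {ffun 'I_N -> 'I_phi.+1} -> tpoly R.

Section System.
Context {R : realType} {N phi : nat}.
Variables (w1 w2 : R) (F : polyfield R N phi).

Definition field_eval (x : 'cV[R]_N) (t : R) : 'cV[R]_N :=
  \col_i \sum_(a : {ffun 'I_N -> 'I_phi.+1} | (\sum_k a k <= phi)%N)
    teval w1 w2 (F i a) t * \prod_k x k ord0 ^+ a k.

Definition of_degree : Prop :=
  exists i (a : {ffun 'I_N -> 'I_phi.+1}) h,
    (\sum_k a k = phi)%N /\ tcoef (F i a) h <> 0.

(* A solution on the whole line that is quasi-periodic with base frequencies
   w1 and w2: a continuous function on the 2-torus, read along the flow of
   direction (w1, w2). *)
Definition is_response (x : R -> 'cV[R]_N) : Prop :=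
  (forall t i, is_derive t (1 : R) (fun s => x s i ord0)
                 (field_eval (x t) t i ord0)) /\
  exists X : R * R -> 'cV[R]_N,
    [/\ forall i, continuous (fun u => X u i ord0),
        forall a b, X (a + 2 * pi, b) = X (a, b),
        forall a b, X (a, b + 2 * pi) = X (a, b) &
        forall t, x t = X (w1 * t, w2 * t)].

Variable p : nat.
Implicit Type xh : 'cV[R]_(N * hdim p).

Definition truncation xh (i : 'I_N) : tpoly R :=
  [seq (xh (mxtens_index (i, j)) ord0, hbasis j) | j <- enum 'I_(hdim p)].

(* The product-to-sum expansion of f_i along the truncated response. *)
Definition field_expansion xh (i : 'I_N) : tpoly R :=
  flatten [seq tmul (F i a)
             (foldr (fun k P => tmul (texp (truncation xh k) (a k)) P) tone
                (enum 'I_N))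
          | a : {ffun 'I_N -> 'I_phi.+1} <- enum {ffun 'I_N -> 'I_phi.+1}
            & (\sum_k a k <= phi)%N].

Definition expands_in_Omega : Prop :=
  forall xh i (l : label), (phi * p < `|l.1| + `|l.2|)%N ->
    tcoef (field_expansion xh i) (Cos l) = 0 /\
    tcoef (field_expansion xh i) (Sin l) = 0.

Definition fhat xh : 'cV[R]_(N * hdim p) :=
  \col_r let: (i, j) := mxtens_unindex r in
         tcoef (field_expansion xh i) (hbasis j).

(* Entries of the 2x2 block [[0, w], [-w, 0]] sitting on the rows and columns
   Cos l, Sin l. *)
Definition nabla_entry (h k : wave) : R :=
  match h, k with
  | Cos l, Sin l' => if l == l' then freq w1 w2 l else 0
  | Sin l, Cos l' => if l == l' then - freq w1 w2 l else 0
  | _, _ => 0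
  end.

Definition nabla : 'M[R]_(N * hdim p) :=
  tensmx (1%:M : 'M[R]_N)
         (\matrix_(j, k) nabla_entry (hbasis j) (hbasis k)).

Definition MHB xh : Prop := nabla *m xh = fhat xh.

Section Sampling.
Variables (T : R) (M : nat).

(* Nodes are numbered from 0. *)
Definition node (i : 'I_M) : R := T * i%:R / M%:R.

Definition Bmx : 'M[R]_(M, hdim p) :=
  \matrix_(i, j) heval w1 w2 (hbasis j) (node i).

Definition Bstar : 'M[R]_(hdim p, M) :=
  \matrix_(j, i) ((if j == 0 :> nat then 2^-1 else 1) *
                  ((2 / M%:R) *: Bmx^T) j i).

Definition Emx : 'M[R]_(N * M, N * hdim p) := tensmx (1%:M : 'M[R]_N) Bmx.

Definition Estar : 'M[R]_(N * hdim p, N * M) := tensmx (1%:M : 'M[R]_N) Bstar.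

(* y stacks, component by component, the values of x at the nodes. *)
Definition ftilde (y : 'cV[R]_(N * M)) : 'cV[R]_(N * M) :=
  \col_r let: (i, k) := mxtens_unindex r in
         field_eval (\col_i' y (mxtens_index (i', k)) ord0) (node k) i ord0.

Definition RMHB xh : Prop :=
  Estar *m Emx *m (nabla *m xh) = Estar *m ftilde (Emx *m xh).

End Sampling.
End System.

Variant maybe_infinite (A : Type) := Fin of A | Infinite.
Arguments Infinite {A}.

(* The value l of a quantity S that depends on the sampling period and on the
   number of nodes, an infinite parameter being replaced by a limit.  When both
   are infinite, the nodes first fill [0, T], then T tends to infinity; an
   unrestricted joint limit would not exist for the sums of cos (w t_i), whose
   normalized value is 1 along T = 2 pi M / w. *)
Definition sampled_value (R : realType) (T : maybe_infinite R) (M : maybe_infinite nat)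
    (S : R -> nat -> R) (l : R) : Prop :=
  match T, M with
  | Fin T, Fin M => S T M = l
  | Fin T, Infinite => S T M @[M --> \oo] --> l
  | Infinite, Fin M => S T M @[T --> +oo] --> l
  | Infinite, Infinite =>
      exists2 g : R -> R,
        forall T, 0 < T -> S T M @[M --> \oo] --> g T &
        g T @[T --> +oo] --> l
  end.

Definition RMHB_equiv_MHB (R : realType) (N phi : nat) (w1 w2 : R)
    (F : polyfield R N phi) (p : nat) (T : maybe_infinite R) (M : maybe_infinite nat) :=
  (forall r s : 'I_(N * hdim p),
     sampled_value T M
       (fun T M => (Estar w1 w2 p T M *m Emx w1 w2 p T M) r s)
       ((1%:M : 'M[R]_(N * hdim p)) r s)) /\
  (forall (xh : 'cV[R]_(N * hdim p)) (r : 'I_(N * hdim p)),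
     sampled_value T M
       (fun T M => (Estar w1 w2 p T M *m
                    ftilde w1 w2 F T (Emx w1 w2 p T M *m xh)) r ord0)
       (fhat F xh r ord0)).

Lemma RMHB_equiv_MHB_coincide (R : realType) (N phi : nat) (w1 w2 : R)
    (F : polyfield R N phi) (p : nat) (T : R) (M : nat)
    (xh : 'cV[R]_(N * hdim p)) :
  RMHB_equiv_MHB w1 w2 F p (Fin T) (Fin M) ->
  RMHB w1 w2 F T M xh <-> MHB w1 w2 F xh.
Proof.
move=> [Ha Hb]; rewrite /RMHB /MHB.
have -> : Estar w1 w2 p T M *m Emx w1 w2 p T M = (1%:M : 'M[R]_(N * hdim p)).
  by apply/matrixP => r s; exact: Ha.
have -> : Estar w1 w2 p T M *m ftilde w1 w2 F T (Emx w1 w2 p T M *m xh) =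
          fhat F xh.
  by apply/matrixP => r s; rewrite ord1; exact: Hb.
by rewrite mul1mx.
Qed.

(* Main.v *)
Require Import Defs.
From HB Require Import structures.
From mathcomp Require Import all_boot all_order all_algebra.
From mathcomp Require Import mxtens ring lra zify.
From mathcomp Require Import all_classical all_reals all_analysis.
Import Order.TTheory GRing.Theory Num.Theory.
Import numFieldNormedType.Exports.
Local Open Scope ring_scope.

(** The condition that [Estar *m Emx] is the identity already forces both
    parameters to be infinite.  In the row of the constant harmonic and the
    column of a nonzero harmonic [h], the product [Estar *m Emx] has the mean of [h] over the nodes
    ([RMHB_equiv_node_mean0]), which must therefore vanish.  Since [1 <= p], this
    applies to the cosine and the sine of both base frequencies, labelled
    [(1, 0)] and [(0, 1)].

    Suppose that [T] is finite and let [w] be a base frequency.  The angles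
    [w t_i] are the multiples [i th] of the step [th = w T / M], so the sum of
    [cos ((i + 1) th) - cos (i th)] over the nodes telescopes to
    [cos (w T) - 1].  By the addition formula it is also a combination of the
    node means of the cosine and of the sine, with coefficients bounded by
    [|w T|] uniformly in [M] ([cos_node_telescope]).  If the two means are zero
    ([M] finite) or tend to zero ([M] infinite), then [cos (w T) = 1], that is,
    [w T] is a multiple of [2 pi].  When this holds for both base frequencies,
    the ratio [w1 / w2] is rational.

    Suppose that [M] is finite and [T] infinite.  All nodes are peaks of
    [cos (w2 t)] whenever [T] is a multiple of [2 pi M / |w2|], so that the node
    mean returns to 1 for arbitrarily large [T] and cannot tend to zero. *)

Lemma cosD2piz (R : realType) (k : int) (x : R) :
  cos (x + k%:~R * (pi *+ 2)) = cos x.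
Proof.
have P := @periodicn _ _ (@cos R) _ (@cosD2pi R).
case: (intP k) => [|n|n]; first by rewrite mul0r addr0.
  by rewrite -pmulrn mulr_natl P.
by rewrite mulrNz -pmulrn mulNr mulr_natl -[LHS](P n.+1) subrK.
Qed.

Lemma cos_eq1 (R : realType) (x : R) :
  cos x = 1 -> exists k : int, x = k%:~R * (pi *+ 2).
Proof.
move=> cx; have pi0 := pi_gt0 R.
(* Rounding to the nearest integer brings x to z between -pi and pi, so that |z|
   lies where cos is injective. *)
exists (Num.floor (x / (pi *+ 2) + 2^-1)).
set k := Num.floor _.
set z := x + (- k)%:~R * (pi *+ 2).
have zpi : `|z| <= pi.
  have /andP[kl ku] : (k%:~R : R) <= x / (pi *+ 2) + 2^-1 < (k + 1)%:~R.
    exact: real_floor_itv (num_real _).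
  rewrite intrD in ku.
  have E : x = x / (pi *+ 2) * (pi *+ 2).
    by rewrite mulfVK // mulrn_eq0 /= gt_eqF.
  rewrite /z intrN mulNr {1}E -mulrBl.
  rewrite ler_norml; apply/andP; split; nra.
have : `|z| = 0.
  apply: (@cos_inj R); rewrite ?in_itv /= ?normr_ge0 ?zpi ?lexx ?ltW //.
  by rewrite cos_norm cosD2piz cx cos0.
by move/normr0_eq0/eqP; rewrite /z intrN mulNr subr_eq0 => /eqP.
Qed.

Lemma sin_ler_norm (R : realType) (x : R) : `|sin x| <= `|x|.
Proof.
wlog x0 : x / 0 <= x => [H|].
  case: (leP 0 x) => [|x0]; first exact: H.
  by rewrite -normrN -sinN -[`|x|]normrN; apply: H; rewrite oppr_ge0 ltW.
have [c _] : exists2 c, c \in `[0, x] & sin x - sin 0 = cos c * (x - 0).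
  apply: MVT_segment => //.
  exact/continuous_subspaceT/continuous_sin.
rewrite sin0 !subr0 => ->.
by rewrite normrM ler_piMl // cos_max.
Qed.

(** The half-angle formula reduces this to the bounds on the sine. *)
Lemma cosB1_ler_norm (R : realType) (x : R) : `|cos x - 1| <= `|x|.
Proof.
have -> : cos x - 1 = - (2 * (sin (x / 2) * sin (x / 2))).
  rewrite {1}(_ : x = (x / 2) *+ 2); last by rewrite -mulr_natr divfK.
  by rewrite cos_mulr2n cos2sin2; ring.
rewrite normrN !normrM (@ger0_norm _ 2) //.
have := sin_ler_norm _ (x / 2); have := sin_max (x / 2).
rewrite normrM (@ger0_norm _ 2^-1) //; have := normr_ge0 (sin (x/2)).
nra.
Qed.

Definition node_mean (R : realType) (g : R -> R) (T : R) (M : nat) : R :=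
  M%:R^-1 * \sum_(i < M) g (node T i).
Arguments node_mean {R}.

(** The factors [M] are kept next to [cos th - 1] and [sin th], where
    [th = w T / M], because the products are bounded independently of [M]. *)
Lemma cos_node_telescope (R : realType) (w T : R) (M : nat) : (0 < M)%N ->
  cos (w * T) - 1 =
    node_mean (fun t => cos (w * t)) T M * (M%:R * (cos (w * T / M%:R) - 1))
  - node_mean (fun t => sin (w * t)) T M * (M%:R * sin (w * T / M%:R)).
Proof.
move=> M0; have Mn : M%:R != 0 :> R by rewrite pnatr_eq0 -lt0n.
set th := w * T / M%:R.
have E (n : nat) : cos (n%:R * th) - 1 =
    (\sum_(i < n) cos (i%:R * th)) * (cos th - 1)
  - (\sum_(i < n) sin (i%:R * th)) * sin th.
  elim: n => [|n IH]; first by rewrite !big_ord0 !mul0r cos0 !subrr.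
  rewrite !big_ord_recr /= -natr1 mulrDl mul1r cosD.
  have -> : cos (n%:R * th) * cos th - sin (n%:R * th) * sin th - 1 =
    (cos (n%:R * th) - 1) + cos (n%:R * th) * (cos th - 1)
      - sin (n%:R * th) * sin th by ring.
  by rewrite IH; ring.
have N (g : R -> R) : M%:R * node_mean (fun t => g (w * t)) T M =
    \sum_(i < M) g (i%:R * th).
  rewrite /node_mean mulVKf //; apply: eq_bigr => i _.
  by congr g; rewrite /node /th; ring.
rewrite !(mulrCA (node_mean _ _ _)) ![M%:R * (node_mean _ _ _ * _)]mulrA !N -E.
by rewrite /th [M%:R * _]mulrC divfK.
Qed.

(** With the limits as hypotheses, the telescoped identity replaces the
    convergence of the Riemann sums to integrals over the sampling period: its
    left-hand side does not depend on [M], and its right-hand side tends to 0. *)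
Lemma cvg_node_mean_cos1 (R : realType) (w T : R) :
  (node_mean (fun t => cos (w * t)) T M @[M --> \oo] --> 0)%classic ->
  (node_mean (fun t => sin (w * t)) T M @[M --> \oo] --> 0)%classic ->
  cos (w * T) = 1.
Proof.
move=> C S; apply/eqP; rewrite -subr_eq0 -normr_le0.
set c := node_mean _ T in C; set s := node_mean _ T in S.
have L : ((`|c M| + `|s M|) * `|w * T| @[M --> \oo] --> 0)%classic.
  rewrite -(mul0r `|w * T|) -(addr0 0) -{1 2}(@normr0 R R).
  by apply: cvgM; [apply: cvgD; exact: cvg_norm | exact: cvg_cst].
apply: (@cvgr_to_ge _ _ _ _ _ _ _ L).
near=> M.
have M0 : (0 < M)%N by near: M; exact: nbhs_infty_gt.
rewrite (@cos_node_telescope _ w T M M0) -/(c M) -/(s M).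
have B (x : R) : `|x| <= `|w * T / M%:R| -> `|M%:R * x| <= `|w * T|.
  rewrite !normrM normfV [_ / _]mulrC ler_pdivlMl //.
  by rewrite normr_gt0 pnatr_eq0 -lt0n.
rewrite mulrDl (le_trans (ler_normB _ _)) // lerD // normrM ler_wpM2l //.
- exact/B/cosB1_ler_norm.
- exact/B/sin_ler_norm.
Unshelve. all: by end_near. Qed.

(** For fixed [M] the node mean is periodic in [T]: it takes the value 1 at all
    the multiples of [2 pi M / |w|]. *)
Lemma not_cvg_node_mean_cos (R : realType) (w : R) (M : nat) :
  w != 0 -> (0 < M)%N ->
  ~ (node_mean (fun t => cos (w * t)) T M @[T --> +oo%R] --> 0)%classic.
Proof.
move=> w0 M0 H; have Mn : M%:R != 0 :> R by rewrite pnatr_eq0 -lt0n.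
have a0 : 0 < pi *+ 2 * M%:R / `|w|.
  by rewrite !mulr_gt0 ?invr_gt0 ?normr_gt0 ?ltr0n // mulrn_wgt0 // pi_gt0.
have /cvgr0_norm_lt/(_ 1 ltr01) [A [_ HA]] := H.
have [j] : exists j : nat, A < j%:R * (pi *+ 2 * M%:R / `|w|).
  exists (Num.truncn (A / (pi *+ 2 * M%:R / `|w|))).+1.
  by rewrite -ltr_pdivrMr // truncnS_gt.
move=> /HA /=; rewrite /node_mean (eq_bigr (fun=> 1)).
  by rewrite sumr_const card_ord mulVf // normr1 ltxx.
move=> i _; rewrite -cos_norm normrM /node.
have -> : `|w| * `|j%:R * (pi *+ 2 * M%:R / `|w|) * i%:R / M%:R| =
   0 + (j * i)%:Z%:~R * (pi *+ 2).
  rewrite [X in _ * X]ger0_norm; last first.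
    by do 3 (rewrite mulr_ge0 ?invr_ge0 ?ler0n //); exact: ltW.
  rewrite -pmulrn natrM add0r; field.
  by rewrite Mn normr_eq0 w0.
by rewrite cosD2piz cos0.
Qed.

Lemma commensurable_rational (R : realType) (w1 w2 T : R) :
  w2 * T != 0 -> cos (w1 * T) = 1 -> cos (w2 * T) = 1 ->
  rational (w1 / w2).
Proof.
move=> wT /cos_eq1[a Ha] /cos_eq1[b Hb].
have [w20 T0] : w2 != 0 /\ T != 0 by move: wT; rewrite mulf_eq0 negb_or => /andP.
exists (a%:~R / b%:~R) => //; rewrite fmorph_div /= !ratr_int.
have b0 : b%:~R != 0 :> R.
  by apply: contra_neq wT => b0; rewrite Hb b0 mul0r.
have p0 : pi *+ 2 != 0 :> R by rewrite mulrn_eq0 /= gt_eqF // pi_gt0.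
rewrite -(mulfK p0 a%:~R) -(mulfK p0 b%:~R) -Ha -Hb.
by move: (pi *+ 2) p0 => P p0; field; rewrite w20 T0 p0.
Qed.

Definition wave_code (h : wave) : bool * label :=
  match h with Cos l => (true, l) | Sin l => (false, l) end.

Definition wave_decode (c : bool * label) : wave :=
  if c.1 then Cos c.2 else Sin c.2.

Lemma wave_codeK : cancel wave_code wave_decode.
Proof. by case. Qed.

(** The equality structure lets the position of a harmonic in the basis be
    found with [index]. *)
HB.instance Definition _ := Equality.copy wave (can_type wave_codeK).

Lemma mem_Omega (p : nat) (l : label) :
  (`|l.1| + `|l.2| <= p)%N -> (0 < l.2) || ((l.2 == 0) && (0 <= l.1)) ->
  l \in Omega p.
Proof.
case: l => m n mnp half; rewrite mem_filter mnp half andTb.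
have Z (k : int) : (`|k| <= p)%N -> k \in zrange p.
  move=> kp; apply/mapP; exists (absz (k + p%:Z)); first by rewrite mem_iota; lia.
  lia.
by apply: allpairs_f; apply: Z; move: mnp => /=; lia.
Qed.

Lemma hbasis_of_Omega (p : nat) (l : label) (h : wave) :
  l \in Omega p -> l != (0, 0) -> h \in [:: Cos l; Sin l] ->
  exists j : 'I_(hdim p), hbasis j = h.
Proof.
move=> lp l0 hl.
have hp : h \in harmonics p.
  rewrite inE; apply/orP; right; apply/flatten_mapP.
  by exists l => //; rewrite mem_filter l0.
by exists (Ordinal (etrans (index_mem _ _) hp)); exact: nth_index.
Qed.

(** The entry read is the one in the row of the constant harmonic and in the
    column of [h], which is off the diagonal.  The factor [2^-1] carried by the
    first row of [Bstar] cancels the 2 of [2 / M]. *)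
Lemma RMHB_equiv_node_mean0 (R : realType) (N phi : nat) (w1 w2 : R)
    (F : polyfield R N phi) (p : nat) (T : maybe_infinite R)
    (M : maybe_infinite nat) (l : label) (h : wave) :
  (0 < N)%N -> l \in Omega p -> l != (0, 0) -> h \in [:: Cos l; Sin l] ->
  RMHB_equiv_MHB w1 w2 F p T M ->
  sampled_value T M (node_mean (heval w1 w2 h)) 0.
Proof.
move=> N0 lp l0 hl [Ha _].
have [j hj] := hbasis_of_Omega _ _ _ lp l0 hl.
pose i := Ordinal N0; pose j0 : 'I_(hdim p) := Ordinal (ltn0Sn _).
have := Ha (mxtens_index (i, j0)) (mxtens_index (i, j)).
rewrite mxE (can_eq (@mxtens_indexK _ _)).
have -> : ((i, j0) == (i, j)) = false.
  apply/negP => /eqP[jE]; move: hl; rewrite -hj /hbasis -jE /= !inE.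
  by case/orP => /eqP // -[lE]; rewrite lE eqxx in l0.
suff -> : (fun T M => (Estar w1 w2 p T M *m Emx w1 w2 p T M)
    (mxtens_index (i, j0)) (mxtens_index (i, j))) =
    node_mean (heval w1 w2 h) by [].
apply/funext => t; apply/funext => n.
rewrite /Estar /Emx tensmx_mul tensmxE mulmx1 !mxE eqxx mul1r /node_mean mulr_sumr.
apply: eq_bigr => k _; rewrite !mxE /= hj mulrA mulKf //.
by rewrite /freq !mul0r addr0 mul0r cos0 mulr1.
Qed.

Theorem theorem1 (R : realType) (N phi p : nat) (w1 w2 : R)
    (F : polyfield R N phi) (x : R -> 'cV[R]_N)
    (T : maybe_infinite R) (M : maybe_infinite nat) :
  (1 <= N)%N -> (1 <= phi)%N -> (1 <= p)%N ->
  of_degree F ->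
  expands_in_Omega F p ->
  is_response w1 w2 F x ->
  w2 != 0 ->
  irrational (w1 / w2) ->
  (forall t, T = Fin t -> 0 < t) ->
  (forall m, M = Fin m -> (1 <= m)%N) ->
  RMHB_equiv_MHB w1 w2 F p T M ->
  T = Infinite /\ M = Infinite.
Proof.
move=> N0 _ p0 _ _ _ w20 irr T0 M0 equiv.
have mean0 (l : label) : l \in [:: (1, 0); (0, 1)] -> let w := freq w1 w2 l in
    sampled_value T M (node_mean (fun t => cos (w * t))) 0 /\
    sampled_value T M (node_mean (fun t => sin (w * t))) 0.
  move=> lE; have l0 : l != (0, 0) by move: lE; rewrite !inE => /orP[] /eqP->.
  have lp : l \in Omega p.
    by apply: mem_Omega; move: lE; rewrite !inE => /orP[] /eqP->.
  split; [apply: (RMHB_equiv_node_mean0 _ _ _ _ _ _ _ _ _ l (Cos l) N0 lp l0 _ equiv)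
         |apply: (RMHB_equiv_node_mean0 _ _ _ _ _ _ _ _ _ l (Sin l) N0 lp l0 _ equiv)];
  by rewrite !inE eqxx ?orbT.
have [C1 S1] := mean0 (1, 0) isT; have [C2 S2] := mean0 (0, 1) isT.
move: C1 S1 C2 S2; rewrite /freq /= !mul1r !mul0r add0r addr0 => C1 S1 C2 S2.
case: T T0 C1 S1 C2 S2 {equiv mean0} => [T /(_ _ erefl) T0|_] C1 S1 C2 S2.
  have resonance (w : R) :
      sampled_value (Fin T) M (node_mean (fun t => cos (w * t))) 0 ->
      sampled_value (Fin T) M (node_mean (fun t => sin (w * t))) 0 ->
      cos (w * T) = 1.
    case: M M0 {C1 S1 C2 S2} => [m /(_ _ erefl) m0 /= C S|_]; last first.
      exact: cvg_node_mean_cos1.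
    apply/eqP; rewrite -subr_eq0.
    by rewrite (@cos_node_telescope _ w T m m0) C S !mul0r subr0.
  case: irr; apply: (@commensurable_rational _ _ _ T).
  - by rewrite mulf_neq0 // gt_eqF.
  - exact: resonance.
  - exact: resonance.
case: M M0 C1 S1 C2 S2 => [m /(_ _ erefl) m0|//] _ _ C2 _.
by case: (@not_cvg_node_mean_cos _ _ _ w20 m0 C2).
Qed.
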